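(* Let $\mathcal{T}=\langle \mathcal{S},\mathcal{A},p,r,\gamma,\beta,\pi_0\rangle$ and $\widetilde{\mathcal{T}}=\langle \mathcal{S},\mathcal{A},p,\widetilde{r},\gamma,\beta,\pi_0\rangle$ be entropy-regularized tasks differing only in their reward functions, with optimal action-value functions, optimal state-value functions and optimal policies $(Q^*,V^*,\pi^* )$ and $(\widetilde{Q}^*,\widetilde{V}^*,\widetilde{\pi}^* )$ respectively. Let $\bar{\mathcal{T}}=\langle \mathcal{S},\mathcal{A},p,\bar{r},\gamma,\beta,\pi_0\rangle$ be the task with reward function $$\bar{r}(s,a,s') = \widetilde{r}(s,a,s') + \gamma V^*(s') - V^*(s).$$ Then the optimal action-value function of $\bar{\mathcal{T}}$ is, for all $s\in\mathcal{S}$, $a\in\mathcal{A}$, $$\bar{Q}^*(s,a) = \widetilde{Q}^*(s,a) - Q^*(s,a) + \frac{1}{\beta}\log\frac{\pi^*(a\mid s)}{\pi_0(a\mid s)} = \widetilde{Q}^*(s,a) - V^*(s),$$ and the optimal policy of $\bar{\mathcal{T}}$ is $\bar{\pi}^*(a\mid s)=\widetilde{\pi}^*(a\mid s)$.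
   Context: An entropy-regularized task $\langle \mathcal{S},\mathcal{A},p,r,\gamma,\beta,\pi_0\rangle$ consists of discrete (finite or countable) state and action sets $\mathcal{S},\mathcal{A}$, transition dynamics $p(s'\mid s,a)$ (a probability distribution over $s'$ for each $(s,a)$), a bounded reward function $r\colon \mathcal{S}\times\mathcal{A}\times\mathcal{S}\to\mathbb{R}$, a discount factor $\gamma\in(0,1)$, an inverse temperature $\beta>0$, and a prior policy $\pi_0\colon\mathcal{S}\times\mathcal{A}\to(0,1)$ (for each $s$, $\pi_0(\cdot\mid s)$ is a probability distribution on $\mathcal{A}$). The optimal action-value function $Q^*$ of the task is the (unique) bounded solution of the soft Bellman optimality equation $$Q^*(s,a) = \mathbb{E}_{s'\sim p(\cdot\mid s,a)}\left[r(s,a,s') + \frac{\gamma}{\beta}\log \mathbb{E}_{a'\sim\pi_0(\cdot\mid s')} e^{\beta Q^*(s',a')}\right].$$ The optimal state-value function is $V^*(s)=\frac{1}{\beta}\log\sum_a\pi_0(a\mid s)e^{\beta Q^*(s,a)}$, and the optimal policy is $\pi^*(a\mid s)=\pi_0(a\mid s)e^{\beta Q^*(s,a)}/\sum_{a'}\pi_0(a'\mid s)e^{\beta Q^*(s,a')}$. *)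

(* Defs.v *)
From HB Require Import structures.
From mathcomp Require Import all_boot all_order all_algebra.
From mathcomp Require Import all_classical all_reals all_analysis.
Set Implicit Arguments.
Unset Strict Implicit.
Unset Printing Implicit Defensive.
Import Order.TTheory GRing.Theory Num.Theory.
Local Open Scope classical_set_scope.
Local Open Scope ring_scope.

Section discrete_sums.
Context {R : realType} {T : countType}.

(* Sum of a real family over a countable type. [esum] is only meaningful for
   nonnegative terms, hence the split into positive and negative parts, as in
   the library's integral; this is the usual unordered sum for every absolutely
   summable [f]. *)
Definition dsum (f : T -> R) : R :=
  fine (\esum_(x in [set: T]) ((EFin \o f)^\+ x)%E
        - \esum_(x in [set: T]) ((EFin \o f)^\- x)%E)%E.

Definition is_distr (w : T -> R) : Prop :=
  (forall x, 0 <= w x) /\ \esum_(x in [set: T]) (w x)%:E = 1%E.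

Definition expect (w f : T -> R) : R := dsum (fun x => w x * f x).

End discrete_sums.

Section tasks.
Context {R : realType} {S A : countType}.

(* [trans s a s'] is p(s' | s, a) and [prior s a] is pi_0(a | s). *)
Record task := Task {
  trans : S -> A -> S -> R;
  reward : S -> A -> S -> R;
  gamma : R;
  beta : R;
  prior : S -> A -> R
}.

Record is_task (T : task) : Prop := IsTask {
  trans_distr : forall s a, is_distr (trans T s a);
  reward_bounded : exists M, forall s a s', `|reward T s a s'| <= M;
  gamma_itv : 0 < gamma T < 1;
  beta_gt0 : 0 < beta T;
  prior_itv : forall s a, 0 < prior T s a < 1;
  prior_distr : forall s, is_distr (prior T s)
}.

Definition with_reward (T : task) (r : S -> A -> S -> R) : task :=
  Task (trans T) r (gamma T) (beta T) (prior T).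

Definition soft_bellman (T : task) (Q : S -> A -> R) : Prop :=
  forall s a, Q s a =
    expect (trans T s a) (fun s' => reward T s a s' +
      gamma T / beta T *
        ln (expect (prior T s') (fun a' => expR (beta T * Q s' a')))).

(* Uniqueness of the bounded solution is a theorem, so it is not built into
   the definition. *)
Definition is_optimal_Q (T : task) (Q : S -> A -> R) : Prop :=
  (exists M, forall s a, `|Q s a| <= M) /\ soft_bellman T Q.

(* [Q] is meant to be the optimal action-value function of [T]. *)
Definition optimal_V (T : task) (Q : S -> A -> R) (s : S) : R :=
  (beta T)^-1 * ln (dsum (fun a => prior T s a * expR (beta T * Q s a))).

Definition optimal_policy (T : task) (Q : S -> A -> R) (s : S) (a : A) : R :=
  prior T s a * expR (beta T * Q s a) /
    dsum (fun a' => prior T s a' * expR (beta T * Q s a')).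

End tasks.

Arguments task : clear implicits.

(* Main.v *)
(** Adding a function [c s] of the state to [Q] shifts the soft value by [c s],
    because [exp (beta * c s)] factors out of the partition function. With
    [c = - V], the potential terms [gamma * V s' - V s] of the shaped reward
    cancel in the soft Bellman equation, so [Qt - V] solves it; it is the only
    bounded solution since the soft Bellman backup is monotone and maps a
    constant shift [K] to the shift [gamma * K]. The same factor cancels in the
    Boltzmann policy. *)
Require Import Defs.
From HB Require Import structures.
From mathcomp Require Import all_boot all_order all_algebra.
From mathcomp Require Import all_classical all_reals all_analysis.
From mathcomp Require Import ring lra.
Set Implicit Arguments.
Unset Strict Implicit.
Unset Printing Implicit Defensive.
Import Order.TTheory GRing.Theory Num.Theory.
Local Open Scope ring_scope.
Import numFieldNormedType.Exports.
Local Open Scope classical_set_scope.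

(** * Expectation of bounded functions under a discrete distribution *)

Section expectation.
Context {R : realType} {T : countType}.
Implicit Types (w f g : T -> R) (c M : R).

(** The sum is a supremum of finite partial sums, and a nonnegative factor passes through both. *)
Lemma ge0_esumZl c f : 0 <= c -> (forall x, 0 <= f x) ->
  \esum_(x in [set: T]) (c * f x)%:E =
  (c%:E * \esum_(x in [set: T]) (f x)%:E)%E.
Proof.
move=> c0 f0; rewrite /esum -ereal_supZl//; last first.
  apply/set0P; exists 0%E; exists set0; first exact: fsets_set0.
  by rewrite fsbig_set0.
congr ereal_sup; rewrite image_comp; apply: eq_imagel => X _ /=.
rewrite ge0_mule_fsumr; last by move=> x; rewrite lee_fin.
by apply: eq_fsbigr => x _; rewrite EFinM.
Qed.

(** [f] and [g] may differ from the positive and negative parts of [f - g]; finiteness of both sums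
    makes the value independent of the decomposition. *)
Lemma dsumB f g : (forall x, 0 <= f x) -> (forall x, 0 <= g x) ->
  (\esum_(x in [set: T]) (f x)%:E < +oo)%E ->
  (\esum_(x in [set: T]) (g x)%:E < +oo)%E ->
  dsum (fun x => f x - g x) =
  fine (\esum_(x in [set: T]) (f x)%:E) - fine (\esum_(x in [set: T]) (g x)%:E).
Proof.
move=> f0 g0 fy gy.
have fin (h : T -> R) : (forall x, 0 <= h x) ->
    (\esum_(x in [set: T]) (h x)%:E < +oo)%E ->
    \esum_(x in [set: T]) (h x)%:E \is a fin_num.
  move=> h0 hy; rewrite ge0_fin_numE//; apply: esum_ge0 => x _.
  by rewrite lee_fin h0.
have sum (h : T -> R) : (forall x, 0 <= h x) ->
    (\esum_(x in [set: T]) (h x)%:E < +oo)%E ->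
    summable [set: T] (EFin \o h).
  move=> h0; apply: le_lt_trans; apply: le_esum => x _.
  by rewrite lee_fin ger0_norm.
rewrite -fineB ?fin//.
by rewrite -(esumB (sum _ f0 fy) (sum _ g0 gy))// => x _; rewrite lee_fin.
Qed.

Variable w : T -> R.
Hypothesis w_distr : is_distr w.

(* Shifting by a lower bound [- M] turns the expectation into a sum of
   nonnegative terms. *)
Lemma expect_shiftE f M K :
    (forall x, 0 <= f x + M) -> (forall x, f x <= K) ->
  \esum_(x in [set: T]) (w x * (f x + M))%:E = (expect w f + M)%:E.
Proof.
(* [M] may be negative. The nonnegative shift [N] makes [N * w x] a family that [dsumB] can
   subtract; the gap [N - M >= 0] then leads back to [M]. *)
have [w0 w1] := w_distr => fM fK; pose N := `|M|.
have N0 : 0 <= N by rewrite normr_ge0.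
have MN : M <= N by rewrite ler_norm.
have esumw c : 0 <= c -> \esum_(x in [set: T]) (c * w x)%:E = c%:E.
  by move=> c0; rewrite ge0_esumZl// w1 mule1.
have fN x : 0 <= f x + N by rewrite (le_trans (fM x))// lerD2l.
have wf0 m : (forall x, 0 <= f x + m) -> forall x, 0 <= w x * (f x + m).
  by move=> fm x; rewrite mulr_ge0.
have fin m : m <= N -> (forall x, 0 <= f x + m) ->
    (\esum_(x in [set: T]) (w x * (f x + m))%:E < +oo)%E.
  move=> mN fm; apply: (@le_lt_trans _ _ (`|K| + N)%:E); last exact: ltry.
  rewrite -(esumw (`|K| + N)) ?addr_ge0//; apply: le_esum => x _.
  rewrite lee_fin mulrC ler_wpM2r// lerD// (le_trans (fK x))//.
  exact: ler_norm.
have EN : expect w f = fine (\esum_(x in [set: T]) (w x * (f x + N))%:E) - N.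
  have -> : expect w f = dsum (fun x => w x * (f x + N) - N * w x).
    by congr dsum; apply/funext => x; rewrite mulrDr (mulrC N) addrK.
  rewrite dsumB ?esumw ?ltry//; first exact: wf0.
  - by move=> x; rewrite mulr_ge0.
  - exact: fin.
have : \esum_(x in [set: T]) (w x * (f x + N))%:E =
    (\esum_(x in [set: T]) (w x * (f x + M))%:E + (N - M)%:E)%E.
  rewrite -(esumw (N - M)) ?subr_ge0// -esumD.
  - by apply: eq_esum => x _; rewrite -EFinD; congr EFin; ring.
  - by move=> x _; rewrite lee_fin wf0.
  - by move=> x _; rewrite lee_fin mulr_ge0// subr_ge0.
have : \esum_(x in [set: T]) (w x * (f x + M))%:E \is a fin_num.
  rewrite ge0_fin_numE ?fin//.
  by apply: esum_ge0 => x _; rewrite lee_fin wf0.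
by move=> /fineK <- E; rewrite EN E -EFinD /=; congr EFin; ring.
Qed.

Lemma bounded_shift f M : (forall x, `|f x| <= M) ->
  (forall x, 0 <= f x + M) /\ (forall x, f x <= M).
Proof.
by move=> fM; split=> x; move: (fM x); rewrite ler_norml => /andP[]; lra.
Qed.

(** Shifting [f + c] by [M - c] and [f] by [M] produces the same nonnegative sum. *)
Lemma expectDr f M c : (forall x, `|f x| <= M) ->
  expect w (fun x => f x + c) = expect w f + c.
Proof.
move=> /bounded_shift[f0 fM].
have fc0 x : 0 <= f x + c + (M - c) by move: (f0 x); lra.
have fcM x : f x + c <= M + c by rewrite lerD2r.
have := expect_shiftE fc0 fcM.
have -> : (fun x => (w x * (f x + c + (M - c)))%:E) =
          (fun x => (w x * (f x + M))%:E).
  by apply/funext => x; congr (_ * _)%:E; ring.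
by rewrite (expect_shiftE f0 fM) => -[] ?; lra.
Qed.

Lemma expectZl f M c : 0 <= c -> (forall x, `|f x| <= M) ->
  expect w (fun x => c * f x) = c * expect w f.
Proof.
move=> c0 /bounded_shift[f0 fM].
have cf0 x : 0 <= c * f x + c * M by rewrite -mulrDr mulr_ge0.
have cfM x : c * f x <= c * M by rewrite ler_wpM2l.
have := expect_shiftE cf0 cfM.
under eq_esum do rewrite -mulrDr mulrCA.
rewrite ge0_esumZl//; last by move=> x; rewrite mulr_ge0//; exact: w_distr.1.
by rewrite (expect_shiftE f0 fM) => -[]; rewrite mulrDr => /addIr.
Qed.

(** With the shift [- c] every term of the sum vanishes. *)
Lemma expect_cst c : expect w (fun=> c) = c.
Proof.
have c0 (x : T) : 0 <= c - c by rewrite subrr.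
have := expect_shiftE c0 (fun=> lexx c).
rewrite esum1; last by move=> x _; rewrite subrr mulr0.
by move=> [/esym/subr0_eq].
Qed.

Lemma le_expect f g M : (forall x, `|f x| <= M) -> (forall x, `|g x| <= M) ->
  (forall x, f x <= g x) -> expect w f <= expect w g.
Proof.
move=> fM gM fg.
have [f0 fK] := bounded_shift fM; have [g0 gK] := bounded_shift gM.
rewrite -(lerD2r M) -lee_fin -(expect_shiftE f0 fK) -(expect_shiftE g0 gK).
apply: le_esum => x _.
by rewrite lee_fin ler_wpM2l ?lerD2r//; exact: w_distr.1.
Qed.

End expectation.

(** * Soft values and uniqueness of the bounded soft Bellman solution *)

Section soft_bellman_operator.
Context {R : realType} {S A : countType}.
Variable T : task R S A.
Hypothesis T_task : is_task T.
Implicit Types (Q : S -> A -> R) (M K : R).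

Let beta_gt0 : 0 < beta T. Proof. exact: beta_gt0 T_task. Qed.
Let prior_distr s : is_distr (prior T s).
Proof. exact: prior_distr T_task s. Qed.

Lemma expR_bounded Q M s : (forall a, `|Q s a| <= M) ->
  forall a, `|expR (beta T * Q s a)| <= expR (beta T * M).
Proof.
move=> QM a; rewrite ger0_norm ?expR_ge0// ler_expR ler_pM2l//.
exact: le_trans (ler_norm _) (QM a).
Qed.

(** The integrand stays above the constant [expR (beta T * - M)], which is its own expectation.
    Positivity is what the laws of [ln] require below. *)
Lemma partition_gt0 Q M s : (forall a, `|Q s a| <= M) ->
  0 < expect (prior T s) (fun a => expR (beta T * Q s a)).
Proof.
move=> QM; apply: lt_le_trans (expR_gt0 (beta T * - M)) _.
rewrite -[leLHS](expect_cst (prior_distr s)).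
apply: (le_expect (prior_distr s) (M := expR (beta T * `|M|))) => a.
- by rewrite ger0_norm ?expR_ge0// ler_expR ler_pM2l// -normrN ler_norm.
- apply: expR_bounded => {}a; exact: le_trans (QM a) (ler_norm _).
- by rewrite ler_expR ler_pM2l//; move: (QM a); rewrite ler_norml => /andP[].
Qed.

Lemma optimal_VDr Q M K s : (forall a, `|Q s a| <= M) ->
  optimal_V T (fun s a => Q s a + K) s = optimal_V T Q s + K.
Proof.
move=> QM; rewrite /optimal_V -!/(expect _ _).
under eq_fun do rewrite mulrDr addrC expRD.
rewrite (expectZl (prior_distr s) (expR_ge0 _) (expR_bounded QM)).
rewrite lnM ?posrE ?expR_gt0 ?(partition_gt0 QM)// expRK.
by rewrite mulrDr mulKf ?gt_eqF// addrC.
Qed.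

Lemma le_optimal_V Q Q' M s :
    (forall a, `|Q s a| <= M) -> (forall a, `|Q' s a| <= M) ->
    (forall a, Q s a <= Q' s a) ->
  optimal_V T Q s <= optimal_V T Q' s.
Proof.
move=> QM Q'M QQ'; rewrite /optimal_V -!/(expect _ _).
rewrite ler_pM2l ?invr_gt0// ler_ln ?posrE ?(partition_gt0 QM)//; last first.
  exact: partition_gt0 Q'M.
apply: (le_expect (prior_distr s) (expR_bounded QM) (expR_bounded Q'M)) => a.
by rewrite ler_expR ler_pM2l.
Qed.

Lemma optimal_V_cst K s : optimal_V T (fun _ _ => K) s = K.
Proof.
rewrite /optimal_V -/(expect _ _) (expect_cst (prior_distr s)) expRK.
by rewrite mulKf ?gt_eqF.
Qed.

(** [Q s] lies between the constants [- M] and [M], which are their own soft values, and the soft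
    value is monotone. *)
Lemma ler_norm_optimal_V Q M s : (forall a, `|Q s a| <= M) ->
  `|optimal_V T Q s| <= M.
Proof.
move=> QM.
have QM' a : `|Q s a| <= `|M| by apply: le_trans (QM a) (ler_norm _).
rewrite ler_norml -[X in X <= _ <= _](optimal_V_cst _ s).
rewrite -[X in _ <= _ <= X](optimal_V_cst _ s).
apply/andP; split; apply: (@le_optimal_V _ _ `|M|) => // a; rewrite ?normrN//.
- by move: (QM a); rewrite ler_norml => /andP[].
- exact: le_trans (ler_norm _) (QM a).
Qed.

Lemma soft_bellmanE Q : soft_bellman T Q <-> forall s a,
  Q s a = expect (trans T s a)
            (fun s' => reward T s a s' + gamma T * optimal_V T Q s').
Proof.
suff E s a : expect (trans T s a) (fun s' => reward T s a s' +
      gamma T / beta T *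
        ln (expect (prior T s') (fun a' => expR (beta T * Q s' a')))) =
    expect (trans T s a)
      (fun s' => reward T s a s' + gamma T * optimal_V T Q s').
  by split=> QE s a; rewrite QE E.
by congr expect; apply/funext => s'; rewrite -mulrA.
Qed.

Lemma backup_bounded Q M : (forall s a, `|Q s a| <= M) ->
  exists N, forall s a s', `|reward T s a s' + gamma T * optimal_V T Q s'| <= N.
Proof.
move=> QM; have [L rL] := reward_bounded T_task.
have /andP[g0 _] := gamma_itv T_task.
exists (L + gamma T * M) => s a s'; rewrite (le_trans (ler_normD _ _))//.
by rewrite lerD// normrM (gtr0_norm g0) ler_pM2l// ler_norm_optimal_V.
Qed.

(** A one-sided contraction, in a form that can be iterated: the conclusion is the last hypothesis
    with [gamma T * K] in place of [K]. *)
Lemma soft_bellman_contract Q Q' M K :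
    soft_bellman T Q -> soft_bellman T Q' ->
    (forall s a, `|Q s a| <= M) -> (forall s a, `|Q' s a| <= M) ->
    (forall s a, Q s a <= Q' s a + K) ->
  forall s a, Q s a <= Q' s a + gamma T * K.
Proof.
move=> /soft_bellmanE QE /soft_bellmanE Q'E QM Q'M QQ' s a.
have /andP[g0 _] := gamma_itv T_task.
have p_distr := trans_distr T_task s a.
have [N QN] := backup_bounded QM; have [N' Q'N'] := backup_bounded Q'M.
rewrite QE Q'E -(expectDr p_distr _ (Q'N' s a)).
(* A single bound for the backup of [Q] and the shifted backup of [Q']. *)
apply: (le_expect p_distr (M := `|N| + `|N'| + `|gamma T * K|)) => s'.
- by rewrite (le_trans (QN s a s'))// -addrA ler_wpDr ?ler_norm// addr_ge0.
- rewrite (le_trans (ler_normD _ _))// lerD2r ler_wpDl//.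
  exact: le_trans (Q'N' s a s') (ler_norm _).
rewrite -addrA lerD2l -mulrDr ler_pM2l// -(optimal_VDr _ (Q'M s')).
apply: (@le_optimal_V _ _ (M + `|K|)) => b //.
- by rewrite (le_trans (QM s' b))// lerDl.
- by rewrite (le_trans (ler_normD _ _))// lerD2r.
Qed.

(** Two functions bounded by [N] differ by at most [2 * N]; contracting this gap [n] times and
    letting [n] grow leaves no gap. *)
Lemma optimal_Q_le Q Q' : is_optimal_Q T Q -> is_optimal_Q T Q' ->
  forall s a, Q s a <= Q' s a.
Proof.
move=> [[M QM] QE] [[M' Q'M'] Q'E] s a.
have /andP[g0 g1] := gamma_itv T_task.
pose N : R := `|M| + `|M'|.
have QN t b : `|Q t b| <= N.
  by rewrite (le_trans (QM t b))// ler_wpDr ?ler_norm.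
have Q'N t b : `|Q' t b| <= N.
  by rewrite (le_trans (Q'M' t b))// ler_wpDl ?ler_norm.
have step n t b : Q t b <= Q' t b + N *+ 2 * gamma T ^+ n.
  elim: n t b => [t b|n IH t b].
    rewrite expr0 mulr1; move: (QN t b) (Q'N t b).
    by rewrite !ler_norml mulr2n => /andP[_ ?] /andP[? _]; lra.
  by rewrite exprS mulrCA; exact: soft_bellman_contract QE Q'E QN Q'N IH t b.
rewrite -subr_le0.
have gamma_lt1 : `|gamma T| < 1 by rewrite gtr0_norm.
(* The right-hand [0] is rewritten as the limit of the geometric gaps, each of which bounds
   [Q s a - Q' s a]. *)
have gcvg := @cvg_geometric R (N *+ 2) _ gamma_lt1.
rewrite -(cvg_lim _ gcvg)//; apply: limr_ge; first by apply/cvg_ex; exists 0.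
by apply: nearW => n; rewrite lerBlDl step.
Qed.

Lemma optimal_Q_unique Q Q' : is_optimal_Q T Q -> is_optimal_Q T Q' -> Q = Q'.
Proof.
move=> Qopt Q'opt; apply/funext => s; apply/funext => a; apply/eqP.
by rewrite eq_le !optimal_Q_le.
Qed.

End soft_bellman_operator.

Theorem corollary3 (R : realType) (S A : countType)
    (T : task R S A) (rt : S -> A -> S -> R) (Q Qt : S -> A -> R)
    (hT : is_task T) (hTt : is_task (with_reward T rt))
    (hQ : is_optimal_Q T Q) (hQt : is_optimal_Q (with_reward T rt) Qt) :
  let Tt := with_reward T rt in
  let V := optimal_V T Q in
  let Tb := with_reward T (fun s a s' => rt s a s' + gamma T * V s' - V s) in
  [/\ is_task Tb,
      exists Qb, is_optimal_Q Tb Qb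
    & forall Qb, is_optimal_Q Tb Qb ->
        (forall s a,
           Qb s a = Qt s a - Q s a
                    + (beta T)^-1 * ln (optimal_policy T Q s a / prior T s a) /\
           Qb s a = Qt s a - V s) /\
        (forall s a, optimal_policy Tb Qb s a = optimal_policy Tt Qt s a)].

Proof.
move=> Tt V Tb.
have [[M QM] QE] := hQ; have [[Mt QtMt] QtE] := hQt.
have /andP[g0 g1] := gamma_itv hT; have b0 := beta_gt0 hT.
have VM s : `|V s| <= M by exact: ler_norm_optimal_V.
have hTb : is_task Tb.
  split; [exact: trans_distr hT| |exact: gamma_itv hT|exact: b0
         |exact: prior_itv hT|exact: prior_distr hT].
  have [L rL] := reward_bounded hTt.
  (* The summands bound [rt s a s'], [gamma T * V s'] and [V s] in turn. *)
  exists (L + gamma T * M + M) => s a s' /=.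
  rewrite (le_trans (ler_normB _ _))// lerD// (le_trans (ler_normD _ _))//.
  by rewrite lerD ?rL// normrM gtr0_norm// ler_pM2l.
(* The soft value at [s] reads [Q] only at [s], so the state-dependent shift acts there as the
   constant [- V s]. [Tb] and [Tt] share prior and temperature. *)
have Vb s : optimal_V Tb (fun s a => Qt s a - V s) s = optimal_V Tt Qt s - V s.
  exact: (optimal_VDr hTb (- V s) (QtMt s)).
have Qb_opt : is_optimal_Q Tb (fun s a => Qt s a - V s).
  split.
    exists (Mt + M) => s a; rewrite (le_trans (ler_normB _ _))// lerD//.
  apply/soft_bellmanE => s a; have /soft_bellmanE -> := QtE.
  have [N QtN] := backup_bounded hTt QtMt.
  (* [- V s] does not depend on [s'], so it moves inside the expectation and matches that term of
     the shaped reward; [gamma T * V s'] cancels the shift from [Vb]. *)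
  rewrite -(expectDr (trans_distr hTt s a) _ (QtN s a)).
  by congr expect; apply/funext => s'; rewrite Vb /=; ring.
split => //; first by exists (fun s a => Qt s a - V s).
move=> Qb /(optimal_Q_unique hTb Qb_opt) <-; split => s a.
  split => //; rewrite /optimal_policy -/(expect _ _).
  have /andP[p0 _] := prior_itv hT s a.
  have Z0 := partition_gt0 hT (QM s).
  (* Once the positive prior cancels, the ratio is [expR (beta T * Q s a)] over the partition
     function; its logarithm divided by [beta T] is [Q s a - V s]. *)
  rewrite 2!(mulrAC _ _ (prior T s a)^-1).
  rewrite divff ?gt_eqF// mul1r.
  rewrite ln_div ?posrE ?expR_gt0// expRK mulrBr mulKf ?gt_eqF//.
  by rewrite addrA subrK.
(* The factor [expR (- (beta T * V s))] is independent of the action, hence common to numerator and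
   partition function. *)
have EV b : expR (beta T * (Qt s b - V s)) =
    expR (- (beta T * V s)) * expR (beta T * Qt s b).
  by rewrite -expRD; congr expR; ring.
rewrite /optimal_policy -!/(expect _ _) /= EV; under eq_fun do rewrite EV.
rewrite (expectZl (prior_distr hT s) (expR_ge0 _) (expR_bounded hT (QtMt s))).
by rewrite mulrCA -mulf_div divff ?mul1r// gt_eqF// expR_gt0.
Qed.
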